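(* Let $V$ be a graded vertex coalgebra and let a ($\mathbb{Q}$-graded) vector space $M$ with a linear map $\mathcal{Y}_M(x):M\to(V\otimes M)[[x,x^{-1}]]$ satisfy all the axioms of being a comodule over $V$ except the Jacobi identity, but also satisfy weak coassociativity: for every $v'\in(V\otimes V\otimes M)'$ there exists $k\in\mathbb{Z}_+$ such that for all $w\in M$ $$(x_0+x_2)^k\langle v',(\mathcal{Y}_V(x_0)\otimes Id_M)\mathcal{Y}_M(x_2)w-(Id_V\otimes\mathcal{Y}_M(x_2))\mathcal{Y}_M(x_0+x_2)w\rangle=0.$$ Let $v'\in(V\otimes V\otimes M)'$ and $w\in M$. (a) (Left rationality) The formal series $\langle v',(\mathcal{Y}_V(x_0)\otimes Id_M)\mathcal{Y}_M(x_2)w\rangle$ is in $\mathbb{F}[x_0^{-1},x_2][[x_0,x_2^{-1}]]$ and in fact $$\langle v',(\mathcal{Y}_V(x_0)\otimes Id_M)\mathcal{Y}_M(x_2)w\rangle=\iota_{20}k(x_0,x_2)$$ where $k(x_0,x_2)\in\mathbb{F}[x_0,x_2]_S$ is uniquely determined and is of the form $$k(x_0,x_2)=\frac{h(x_0,x_2)}{x_0^rx_2^s(x_0+x_2)^t}$$ for some $h(x_0,x_2)\in\mathbb{F}[x_0,x_2]$ and $r,s,t\in\mathbb{Z}$. (b) (Coassociativity) It is also the case that $$\iota_{12}^{-1}\langle v',(Id_V\otimes\mathcal{Y}_M(x_2))\mathcal{Y}_M(x_1)w\rangle=\left.\left(\iota_{20}^{-1}\langle v',(\mathcal{Y}_V(x_0)\otimes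 Id_M)\mathcal{Y}_M(x_2)w\rangle\right)\right|_{x_0=x_1-x_2}.$$
   Context: All vector spaces are over a field $\mathbb{F}$ of characteristic $0$; $x,x_0,x_1,x_2$ are commuting formal variables; $\mathbb{Z}_+$ is the set of positive integers. $\delta(x)=\sum_{n\in\mathbb{Z}}x^n$. For $n\in\mathbb{Z}$, $(x_i\pm x_j)^n$ as a formal series is expanded in nonnegative integral powers of the second listed variable $x_j$ (this also applies inside $\delta$ and to $\mathcal{Y}_M(x_0+x_2)$). $W[[x,x^{-1}]]$ is the space of all doubly infinite formal series with coefficients in $W$, and $W((x^{-1}))$ is the space of those with only finitely many positive powers of $x$. $T(u\otimes v)=v\otimes u$ on $V\otimes V$. Linear maps and pairings act on formal series coefficientwise. A vertex coalgebra $(V,\mathcal{Y}_V,c)$ is a vector space $V$ with linear maps $\mathcal{Y}_V(x):V\to(V\otimes V)[[x,x^{-1}]]$ and $c:V\to\mathbb{F}$ such that for all $v\in V$: (left counit) $(c\otimes Id_V)\mathcal{Y}_V(x)v=v$; (cocreation) $(Id_V\otimes c)\mathcal{Y}_V(x)v\in V[[x]]$ and $\lim_{x\to0}(Id_V\otimes c)\mathcal{Y}_V(x)v=v$; (truncation) $\mathcal{Y}_V(x)v\in(V\otimes V)((x^{-1}))$; (Jacobi identity) $$x_0^{-1}\delta\left(\tfrac{x_1-x_2}{x_0}\right)(Id_V\otimes\mathcal{Y}_V(x_2))\mathcal{Y}_V(x_1)-x_0^{-1}\delta\left(\tfrac{x_2-x_1}{-x_0}\right)(T\otimes Id_V)(Id_V\otimes\mathcal{Y}_V(x_1))\mathcal{Y}_V(x_2)=x_2^{-1}\delta\left(\tfrac{x_1-x_0}{x_2}\right)(\mathcal{Y}_V(x_0)\otimes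 Id_V)\mathcal{Y}_V(x_2).$$ It is a graded vertex coalgebra if $V=\coprod_{k\in\mathbb{Z}}V_{(k)}$ is $\mathbb{Z}$-graded with $V_{(k)}=0$ for $k$ sufficiently negative and, writing $\mathcal{Y}_V(x)v=\sum_{k\in\mathbb{Z}}\Delta_k(v)x^{-k-1}$, $\Delta_k(v)\in(V\otimes V)_{(r+k+1)}$ for all $v\in V_{(r)}$, $r,k\in\mathbb{Z}$. The axioms of a comodule $M$ over a graded vertex coalgebra $V$ other than the Jacobi identity are: $M=\coprod_{j\in\mathbb{Q}}M_{(j)}$ is a $\mathbb{Q}$-graded vector space with $M_{(j)}=0$ for $j$ sufficiently negative; writing $\mathcal{Y}_M(x)w=\sum_{k\in\mathbb{Z}}\Delta_k(w)x^{-k-1}$, $\Delta_k(w)\in(V\otimes M)_{(j+k+1)}$ for $w\in M_{(j)}$; and for all $w\in M$: (left counit) $(c\otimes Id_M)\mathcal{Y}_M(x)w=w$; (truncation) $\mathcal{Y}_M(x)w\in(V\otimes M)((x^{-1}))$. For a graded space $W=\coprod_k W_{(k)}$, the graded dual is $W'=\coprod_k\mathrm{Hom}(W_{(k)},\mathbb{F})$, and $\langle\cdot,\cdot\rangle$ is the natural pairing of $W'$ with $W$. Tensor products are graded by total weight. For two variables $x_i,x_j$, $\mathbb{F}[x_i,x_j]_S$ is the ring of rational functions obtained from $\mathbb{F}[x_i,x_j]$ by inverting products of nonzero homogeneous linear polynomials in $x_i,x_j$. The injective map $\iota_{ij}:\mathbb{F}[x_i,x_j]_S\to\mathbb{F}[[x_i,x_i^{-1},x_j,x_j^{-1}]]$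 expands a rational function by expanding negative powers of $x_i\pm x_j$ in nonnegative powers of $x_j$ (powers of $x_i$ and $x_j$ themselves being left unchanged). Thus $\iota_{12}$ expands $(x_1-x_2)^{-t}$ in nonnegative powers of $x_2$, and $\iota_{20}$ expands $(x_0+x_2)^{-t}$ in nonnegative powers of $x_0$. $\iota_{ij}^{-1}$ is the inverse on the image. The substitution $x_0=x_1-x_2$ is made in the rational function. *)

(* Defs.v *)
From HB Require Import structures.
From mathcomp Require Import all_boot all_order all_algebra.
From mathcomp Require Import boolp classical_sets functions cardinality fsbigop.

Set Implicit Arguments.
Unset Strict Implicit.
Unset Printing Implicit Defensive.

Import Order.TTheory GRing.Theory Num.Theory.
Local Open Scope classical_set_scope.
Local Open Scope quotient_scope.
Local Open Scope ring_scope.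

(** * Tensor product of two vector spaces *)

Definition bilinear_map (F : fieldType) (V W U : lmodType F)
    (f : V -> W -> U) : Prop :=
  (forall w, linear (f^~ w)) /\ (forall v, linear (f v)).

Section Tensor.
Variables (F : fieldType) (V W : lmodType F).

(* A list of pairs (v, w) stands for the sum of the pure tensors v (x) w; two
   lists are identified when no bilinear map separates them.  The universal
   property is [tens_lift_linear], [tens_liftE] and [tens_ext] below. *)
Definition tens_eqv (s t : seq (V * W)) : Prop :=
  forall (U : lmodType F) (f : V -> W -> U), bilinear_map f ->
    \sum_(p <- s) f p.1 p.2 = \sum_(p <- t) f p.1 p.2.

Definition tens_rel (s t : seq (V * W)) : bool := `[< tens_eqv s t >].

Lemma tens_rel_refl : reflexive tens_rel.
Proof. by move=> s; apply/asboolP. Qed.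

Lemma tens_rel_sym : symmetric tens_rel.
Proof.
by move=> s t; apply/asboolP/asboolP => H U f bf; rewrite H.
Qed.

Lemma tens_rel_trans : transitive tens_rel.
Proof.
move=> t s u /asboolP st /asboolP tu; apply/asboolP => U f bf.
by rewrite st // tu.
Qed.

Canonical tens_equiv := EquivRel tens_rel
  tens_rel_refl tens_rel_sym tens_rel_trans.

Definition tens := {eq_quot tens_rel}.

HB.instance Definition _ := Choice.on tens.
HB.instance Definition _ : EqQuotient _ tens_rel tens := EqQuotient.on tens.

Lemma tens_eqP (s t : seq (V * W)) :
  (\pi_tens s = \pi_tens t) <-> tens_eqv s t.
Proof. by split => [/eqmodP/asboolP | H]; [|apply/eqmodP/asboolP]. Qed.

Lemma tens_reprP (s : seq (V * W)) : tens_eqv (repr (\pi_tens s)) s.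
Proof. by apply/tens_eqP; rewrite reprK. Qed.

Definition tens0 : tens := \pi_tens [::].
Definition tens_add (x y : tens) : tens := \pi_tens (repr x ++ repr y).
Definition tens_scale (a : F) (x : tens) : tens :=
  \pi_tens [seq (a *: p.1, p.2) | p <- repr x].
Definition tens_opp (x : tens) : tens := tens_scale (-1) x.

(* The linear map induced by a bilinear [f]. *)
Definition tens_lift (U : lmodType F) (f : V -> W -> U) (x : tens) : U :=
  \sum_(p <- repr x) f p.1 p.2.

Lemma tens_eq_lift (x y : tens) :
  (forall (U : lmodType F) (f : V -> W -> U), bilinear_map f ->
     tens_lift f x = tens_lift f y) -> x = y.
Proof. by move=> H; rewrite -[x]reprK -[y]reprK; apply/tens_eqP. Qed.

Section Lift.
Variables (U : lmodType F) (f : V -> W -> U).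
Hypothesis bf : bilinear_map f.

Let fZ a v w : f (a *: v) w = a *: f v w.
Proof.
have f0 : f 0 w = 0.
  have := bf.1 w 1 0 0; rewrite !scale1r addr0 => /eqP.
  by rewrite -[X in X == _]addr0 (inj_eq (addrI _)) => /eqP <-.
by have := bf.1 w a v 0; rewrite addr0 f0 addr0.
Qed.

Lemma tens_lift_pi s : tens_lift f (\pi_tens s) = \sum_(p <- s) f p.1 p.2.
Proof. exact: tens_reprP bf. Qed.

Lemma tens_lift0 : tens_lift f tens0 = 0.
Proof. by rewrite tens_lift_pi big_nil. Qed.

Lemma tens_liftD x y :
  tens_lift f (tens_add x y) = tens_lift f x + tens_lift f y.
Proof. by rewrite tens_lift_pi big_cat. Qed.

Lemma tens_liftZ a x : tens_lift f (tens_scale a x) = a *: tens_lift f x.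
Proof.
rewrite tens_lift_pi big_map /tens_lift scaler_sumr.
by apply: eq_bigr => p _ /=; rewrite fZ.
Qed.
End Lift.

Fact tens_addA : associative tens_add.
Proof.
by move=> x y z; apply: tens_eq_lift => U f bf; rewrite !tens_liftD // addrA.
Qed.
Fact tens_addC : commutative tens_add.
Proof.
by move=> x y; apply: tens_eq_lift => U f bf; rewrite !tens_liftD // addrC.
Qed.
Fact tens_add0 : left_id tens0 tens_add.
Proof.
by move=> x; apply: tens_eq_lift => U f bf; rewrite tens_liftD // tens_lift0 // add0r.
Qed.
Fact tens_addN : left_inverse tens0 tens_opp tens_add.
Proof.
move=> x; apply: tens_eq_lift => U f bf.
by rewrite tens_liftD // tens_liftZ // tens_lift0 // scaleN1r addNr.
Qed.
HB.instance Definition _ :=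
  GRing.isZmodule.Build tens tens_addA tens_addC tens_add0 tens_addN.

Fact tens_scaleA a b x : tens_scale a (tens_scale b x) = tens_scale (a * b) x.
Proof.
by apply: tens_eq_lift => U f bf; rewrite !tens_liftZ // scalerA.
Qed.
Fact tens_scale1 : left_id 1 tens_scale.
Proof.
by move=> x; apply: tens_eq_lift => U f bf; rewrite tens_liftZ // scale1r.
Qed.
Fact tens_scaleDr : right_distributive tens_scale +%R.
Proof.
move=> a x y; apply: tens_eq_lift => U f bf.
by rewrite tens_liftZ // !tens_liftD // !tens_liftZ // scalerDr.
Qed.
Fact tens_scaleDl x : {morph tens_scale^~ x : a b / a + b}.
Proof.
move=> a b; apply: tens_eq_lift => U f bf.
by rewrite tens_liftD // !tens_liftZ // scalerDl.
Qed.
HB.instance Definition _ := GRing.Zmodule_isLmodule.Build F tens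
  tens_scaleA tens_scale1 tens_scaleDr tens_scaleDl.

Definition tpure (v : V) (w : W) : tens := \pi_tens [:: (v, w)].

Lemma tens_lift_linear (U : lmodType F) (f : V -> W -> U) :
  bilinear_map f -> linear (tens_lift f).
Proof. by move=> bf a x y; rewrite tens_liftD // tens_liftZ. Qed.

Lemma tens_liftE (U : lmodType F) (f : V -> W -> U) v w :
  bilinear_map f -> tens_lift f (tpure v w) = f v w.
Proof. by move=> bf; rewrite tens_lift_pi // big_seq1. Qed.

Lemma tpure_bilinear : bilinear_map tpure.
Proof.
split=> [w a u v|v a u w]; apply: tens_eq_lift => U f bf;
  rewrite tens_lift_linear // !tens_liftE //.
- exact: bf.1.
- exact: bf.2.
Qed.

Lemma tens_sumE (x : tens) : x = \sum_(p <- repr x) tpure p.1 p.2.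
Proof.
apply: tens_eq_lift => U f bf.
have lf s : tens_lift f (\sum_(p <- s) tpure p.1 p.2) = \sum_(p <- s) f p.1 p.2.
  elim: s => [|p s IH]; first by rewrite !big_nil tens_lift0.
  by rewrite !big_cons tens_liftD // IH tens_liftE.
by rewrite lf.
Qed.

Lemma tens_ext (U : lmodType F) (f g : {linear tens -> U}) :
  (forall v w, f (tpure v w) = g (tpure v w)) -> f =1 g.
Proof.
move=> H x; rewrite [x]tens_sumE !raddf_sum.
by apply: eq_bigr => p _; exact: H.
Qed.

End Tensor.

Arguments tens {F} V W.
Notation "V ⊗ W" := (tens V W) (at level 40, left associativity) : type_scope.

Section TensorMaps.
Variable F : fieldType.

Definition tmap (V W V' W' : lmodType F) (f : V -> V') (g : W -> W') :
    V ⊗ W -> V' ⊗ W' :=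
  tens_lift (fun v w => tpure (f v) (g w)).

Definition tswap (V : lmodType F) : V ⊗ V -> V ⊗ V :=
  tens_lift (fun u v => tpure v u).

(* The canonical identification of the two bracketings; all triple tensor
   products are bracketed to the left. *)
Definition tassoc (U V W : lmodType F) : U ⊗ (V ⊗ W) -> (U ⊗ V) ⊗ W :=
  tens_lift (fun u => tens_lift (fun v w => tpure (tpure u v) w)).

(* (c (x) Id) and (Id (x) c), composed with F (x) W = W and W (x) F = W. *)
Definition counitl (V W : lmodType F) (c : V -> F) : V ⊗ W -> W :=
  tens_lift (fun v w => c v *: w).
Definition counitr (V W : lmodType F) (c : V -> F) : W ⊗ V -> W :=
  tens_lift (fun w v => c v *: w).

End TensorMaps.

(** * Graded vector spaces *)

Record is_grading (F : fieldType) (I : eqType) (W : lmodType F)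
    (G : I -> set W) : Prop := IsGrading {
  grading0 : forall i, G i 0;
  grading_lin : forall i a u v, G i u -> G i v -> G i (a *: u + v);
  grading_span : forall w, exists (s : seq I) (f : I -> W),
    [/\ uniq s, forall i, G i (f i) & w = \sum_(i <- s) f i];
  grading_indep : forall (s : seq I) (f : I -> W),
    uniq s -> (forall i, G i (f i)) -> \sum_(i <- s) f i = 0 ->
    forall i, i \in s -> f i = 0 }.

Definition bounded_below (F : fieldType) (I : numDomainType) (W : lmodType F)
    (G : I -> set W) : Prop :=
  exists N : I, forall k, k < N -> G k = [set 0].

(* The weight-k space of V (x) W, weights being added by [add]. *)
Definition tgrade (F : fieldType) (I J K : Type) (add : I -> J -> K)
    (V W : lmodType F) (GV : I -> set V) (GW : J -> set W) (k : K) :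
    set (V ⊗ W) :=
  [set x | exists s : seq (V * W),
    (forall p, p \in s -> exists i j, [/\ add i j = k, GV i p.1 & GW j p.2])
    /\ x = \sum_(p <- s) tpure p.1 p.2].

Definition addzq (i : int) (j : rat) : rat := i%:~R + j.

(* An element of the coproduct of the Hom(W_(k), F) is the same thing as a
   functional on W vanishing on all but finitely many of the W_(k); the natural
   pairing is then evaluation. *)
Definition in_graded_dual (F : fieldType) (I : eqType) (W : lmodType F)
    (G : I -> set W) (phi : {scalar W}) : Prop :=
  exists S : seq I, forall k, k \notin S -> forall x, G k x -> phi x = 0.

(** * Formal series *)

(* A doubly infinite series with coefficients in W is its coefficient function
   on exponents: [int], [Z2] or [Z3] according to the number of variables. *)
Notation Z2 := (int * int)%type.
Notation Z3 := (int * int * int)%type.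

(* Product of a scalar series and a W-valued one; only used where every
   coefficient is a finite sum. *)
Definition smul (F : fieldType) (G : zmodType) (W : lmodType F)
    (a : G -> F) (A : G -> W) : G -> W :=
  fun g => \sum_(h \in [set: G]) (a h *: A (g - h)).

Section Series.
Variable F : fieldType.

Definition binomz (n : int) (k : nat) : F :=
  (\prod_(i < k) (n%:~R - i%:R)) / (k`!)%:R.

(* (x + s y)^n, expanded in nonnegative powers of y; exponents of (x, y). *)
Definition binpow (s : F) (n : int) : Z2 -> F := fun e =>
  if (0 <= e.2) && (e.1 == n - e.2) then binomz n `|e.2|%N * s ^+ `|e.2|%N
  else 0.

(* z^-1 delta((x - y) / (u z)) = \sum_n u^-n z^(-n-1) (x - y)^n;
   exponents p, q, r of z, x, y. *)
Definition delta (u : F) (p q r : int) : F :=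
  u ^ (p + 1) * binpow (-1) (- p - 1) (q, r).

(* A(x0 + x2, x2), for A a series in (x1, x2). *)
Definition subst_x0_plus_x2 (W : lmodType F) (A : Z2 -> W) : Z2 -> W :=
  fun e => \sum_(d \in [set: Z2]) (binpow 1 d.1 (e.1, e.2 - d.2) *: A d).

(* Membership in F[x^-1,y][[x,y^-1]]: exponents of x bounded below, exponents
   of y bounded above. *)
Definition left_rational_series (A : Z2 -> F) : Prop :=
  exists N : int, forall e, A e != 0 -> - N <= e.1 /\ e.2 <= N.

End Series.

(** * Vertex coalgebras and comodules *)

(* [Y n] is the coefficient of x^n in Y(x). *)
Section Iterates.
Variables (F : fieldType) (V M : lmodType F).
Variables (YV : int -> V -> V ⊗ V) (YM : int -> M -> V ⊗ M).

(* (Id_V (x) Y_M(x2)) Y_M(x1) w; exponents of (x1, x2). *)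
Definition Yright (w : M) : Z2 -> (V ⊗ V) ⊗ M := fun e =>
  tassoc (tmap id (YM e.2) (YM e.1 w)).

(* (Y_V(x0) (x) Id_M) Y_M(x2) w; exponents of (x0, x2). *)
Definition Yleft (w : M) : Z2 -> (V ⊗ V) ⊗ M := fun e =>
  tmap (YV e.1) id (YM e.2 w).

End Iterates.

Section VertexCoalgebra.
Variables (F : fieldType) (V : lmodType F).
Variables (Y : int -> {linear V -> V ⊗ V}) (c : {scalar V}).

(* The three products of the Jacobi identity; exponents of (x0, x1, x2). *)
Definition jacobi1 (v : V) : Z3 -> (V ⊗ V) ⊗ V :=
  smul (fun e : Z3 => let: (e0, e1, e2) := e in delta (1 : F) e0 e1 e2)
       (fun e : Z3 => let: (e0, e1, e2) := e in
          if e0 == 0 then Yright Y v (e1, e2) else 0).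

Definition jacobi2 (v : V) : Z3 -> (V ⊗ V) ⊗ V :=
  smul (fun e : Z3 => let: (e0, e1, e2) := e in delta (- 1 : F) e0 e2 e1)
       (fun e : Z3 => let: (e0, e1, e2) := e in
          if e0 == 0 then tmap (@tswap F V) id (Yright Y v (e2, e1)) else 0).

Definition jacobi3 (v : V) : Z3 -> (V ⊗ V) ⊗ V :=
  smul (fun e : Z3 => let: (e0, e1, e2) := e in delta (1 : F) e2 e1 e0)
       (fun e : Z3 => let: (e0, e1, e2) := e in
          if e1 == 0 then Yleft Y Y v (e0, e2) else 0).

Record vertex_coalgebra : Prop := VertexCoalgebra {
  vc_counit : forall v n, counitl c (Y n v) = if n == 0 then v else 0;
  vc_cocreation : forall v,
    (forall n, n < 0 -> counitr c (Y n v) = 0) /\ counitr c (Y 0 v) = v;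
  vc_truncation : forall v, exists N : int, forall n, N < n -> Y n v = 0;
  vc_jacobi : forall v e, jacobi1 v e - jacobi2 v e = jacobi3 v e }.

(* Delta_k is the coefficient of x^(-k-1). *)
Record graded_vertex_coalgebra (GV : int -> set V) : Prop :=
  GradedVertexCoalgebra {
  gvc_vertex_coalgebra : vertex_coalgebra;
  gvc_grading : is_grading GV;
  gvc_bounded : bounded_below GV;
  gvc_weight : forall r k v, GV r v ->
    tgrade +%R GV GV (r + k + 1) (Y (- k - 1) v) }.

End VertexCoalgebra.

Section Comodule.
Variables (F : fieldType) (V : lmodType F) (GV : int -> set V).
Variables (YV : int -> {linear V -> V ⊗ V}) (c : {scalar V}).
Variables (M : lmodType F) (GM : rat -> set M).
Variable YM : int -> {linear M -> V ⊗ M}.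

Record comodule_but_jacobi : Prop := ComoduleButJacobi {
  com_grading : is_grading GM;
  com_bounded : bounded_below GM;
  com_weight : forall (j : rat) (k : int) w, GM j w ->
    tgrade addzq GV GM (j + k%:~R + 1) (YM (- k - 1) w);
  com_counit : forall w n, counitl c (YM n w) = if n == 0 then w else 0;
  com_truncation : forall w, exists N : int, forall n, N < n -> YM n w = 0 }.

Definition grade_VVM : rat -> set ((V ⊗ V) ⊗ M) :=
  tgrade addzq (tgrade +%R GV GV) GM.

Definition weak_coassociativity : Prop :=
  forall v' : {scalar (V ⊗ V) ⊗ M}, in_graded_dual grade_VVM v' ->
  exists k : nat, (0 < k)%N /\ forall w : M,
    smul (W := F^o) (binpow 1 k)
      (fun e : Z2 => v' (Yleft YV YM w e - subst_x0_plus_x2 (Yright YM w) e))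
    = (fun=> 0).

End Comodule.

(** * Rational functions and their expansions *)

Notation "x %:F" := (@FracField.tofrac _ x) : ring_scope.

Section Rational.
Variable F : fieldType.

(* F[x,y] is {poly {poly F}} with x = 'X and y = 'X%:P: the coefficient of
   x^i y^j in p is p`_i`_j.  The pair (x, y) is (x1, x2) or (x0, x2). *)
Local Notation ratfun := {fraction {poly {poly F}}}.

Definition var1 : {poly {poly F}} := 'X.
Definition var2 : {poly {poly F}} := 'X%:P.

Definition linform (l : F * F) : {poly {poly F}} :=
  l.1%:P%:P * var1 + l.2%:P%:P * var2.

Definition linprod (ls : seq (F * F)) : {poly {poly F}} :=
  \prod_(l <- ls) linform l.

(* F[x,y]_S *)
Definition loc_S : set ratfun :=
  [set f | exists (h : {poly {poly F}}) (ls : seq (F * F)),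
     0 \notin ls /\ f = h%:F / (linprod ls)%:F].

Definition poly_series (h : {poly {poly F}}) : Z2 -> F := fun e =>
  if (0 <= e.1) && (0 <= e.2) then h`_(`|e.1|%N)`_(`|e.2|%N) else 0.

(* (a x + b y)^-1 expanded in nonnegative powers of y, for (a, b) != 0; when
   a = 0 this is the monomial b^-1 y^-1. *)
Definition invlin_y (l : F * F) : Z2 -> F := fun e =>
  if l.1 != 0 then l.1^-1 * binpow (l.2 / l.1) (-1) e
  else if e == (0, -1) then l.2^-1 else 0.

(* The same, expanded in nonnegative powers of x. *)
Definition invlin_x (l : F * F) : Z2 -> F := fun e =>
  invlin_y (l.2, l.1) (e.2, e.1).

Definition expands (inv : F * F -> Z2 -> F) (f : ratfun) (A : Z2 -> F) : Prop :=
  exists (h : {poly {poly F}}) (ls : seq (F * F)),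
    [/\ 0 \notin ls, f = h%:F / (linprod ls)%:F
      & A = foldr (fun l (B : Z2 -> F^o) => smul (inv l) B)
                  (poly_series h) ls].

(* The expansion does not depend on how f in F[x,y]_S is written as a fraction,
   so the choice made by [xget] is immaterial; junk value 0 outside F[x,y]_S. *)
Definition iota (inv : F * F -> Z2 -> F) (f : ratfun) : Z2 -> F :=
  xget (fun=> 0) [set A | expands inv f A].

Definition iota_image (inv : F * F -> Z2 -> F) : set (Z2 -> F) :=
  iota inv @` loc_S.

(* Inverse of [iota inv] on its image; junk value 0 outside the image. *)
Definition iota_inv (inv : F * F -> Z2 -> F) (A : Z2 -> F) : ratfun :=
  xget 0 [set f | loc_S f /\ iota inv f = A].

Definition iota12 := iota invlin_y.
Definition iota20 := iota invlin_x.
Definition iota12_image := iota_image invlin_y.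
Definition iota20_image := iota_image invlin_x.
Definition iota12_inv := iota_inv invlin_y.
Definition iota20_inv := iota_inv invlin_x.

(* f(x,y) |-> f(x - y, y) *)
Definition subst_x_minus_y (f : ratfun) : ratfun :=
  let sub (p : {poly {poly F}}) := p \Po (var1 - var2) in
  (sub \n_(repr f))%:F / (sub \d_(repr f))%:F.

End Rational.

Arguments var1 {F}.
Arguments var2 {F}.

(* Main.v *)
Require Import Defs.
From HB Require Import structures.
From mathcomp Require Import all_boot all_order all_algebra.
From mathcomp Require Import boolp classical_sets functions cardinality fsbigop.
From mathcomp Require Import zify ring.

Set Implicit Arguments.
Unset Strict Implicit.
Unset Printing Implicit Defensive.

Import Order.TTheory GRing.Theory Num.Theory.
Local Open Scope classical_set_scope.
Local Open Scope ring_scope.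

(** Write B(x0, x2) and A(x1, x2) for the matrix coefficients of the left and
    right iterates, and C(x0, x2) = A(x0 + x2, x2).

    Weak coassociativity says that (x0 + x2)^k B = (x0 + x2)^k C for some k.
    The weight axioms let v' see only finitely many total degrees, so all three
    series live in a strip of exponents; in that strip, truncation bounds the
    exponent of x2 from above in B and from below in C.  The common product is
    therefore supported in a bounded set, i.e. it is a Laurent polynomial
    h / (x0^m x2^m), and B must be the expansion of
    h / (x0^m x2^m (x0 + x2)^k) (lemmas [total_degree_bounded],
    [finite_support_poly], [common_numerator]).

    For A, the substitution x1 = x0 + x2 carries multiplication by
    a x1 + b x2 to multiplication by a x0 + (a + b) x2 ([subst_linmul]), is
    injective on series with exponents of x2 bounded below ([subst_inj]), and
    undoes the polynomial change of variables x0 = x1 - x2 ([subst_poly]).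
    Hence A, multiplied by the transformed denominator, is the transformed
    numerator, which is coassociativity.

    Both conclusions rest on one characterization of expansions ([expandP]): on
    the series allowed by the convention, nonzero linear forms act bijectively,
    so A expands h / (l1 ... ln) if and only if l1 ... ln A = h.  Linear forms
    act on arbitrary doubly infinite series, and working with this action alone
    makes it unnecessary to build a ring of series.  The two recursions on
    binomials, for reciprocals of linear forms and for the substitution, are
    both Pascal's rule, valid for all integer upper arguments in
    characteristic 0. *)

(** * Finite sums over the exponent lattice *)

(** Every series product and substitution below has, coefficient by
    coefficient, its support on an initial segment of a lattice line
    parametrized by the natural numbers; this turns it into an ordinary sum. *)
Lemma fsum_nat (W : nmodType) (f : Z2 -> W) (phi : nat -> Z2) (K : nat) :
  injective phi ->
  (forall d, f d != 0 -> exists2 i, (i < K)%N & d = phi i) ->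
  \sum_(d \in [set: Z2]) f d = \sum_(i < K) f (phi i).
Proof.
move=> phi_inj supp.
rewrite (@fsbigE _ _ _ _ _ [seq phi i | i <- iota 0 K]).
- by rewrite big_map -[in iota 0 K](subn0 K) big_mkord; apply: eq_bigl => i; rewrite in_setT.
- by rewrite map_inj_uniq ?iota_uniq.
- by [].
- move=> d _ /negP dK; apply/eqP/negP => /negP /supp [i iK d_i].
  by apply: dK; rewrite d_i map_f // mem_iota.
Qed.

(** * Generalized binomial coefficients *)

Section Binomial.
Variable F : fieldType.

Lemma binomz0 n : binomz F n 0 = 1.
Proof. by rewrite /binomz big_ord0 fact0 divr1. Qed.

Lemma binomz_0S k : binomz F 0 k.+1 = 0.
Proof. by rewrite /binomz big_ord_recl subrr !mul0r. Qed.

Lemma binomz_pascal (F_char0 : [pchar F] =i pred0) n k :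
  binomz F (n + 1) k.+1 = binomz F n k.+1 + binomz F n k.
Proof.
have nat0 := (GRing.pcharf0P F).1 F_char0.
rewrite /binomz big_ord_recl big_ord_recr /= factS natrM.
rewrite (eq_bigr (fun i : 'I_k => n%:~R - i%:R)); last first.
  by move=> i _; rewrite /bump /= add1n intrD -[i.+1]addn1 natrD; ring.
have k0 : (k`!)%:R != 0 :> F by rewrite nat0 -lt0n fact_gt0.
have k1 : k%:R + 1 != 0 :> F by rewrite natr1 nat0.
by rewrite intrD -natr1; field; rewrite k0 k1.
Qed.

End Binomial.

(** * Multiplication by linear forms *)

Section LinearMultiplication.
Variable F : fieldType.
Implicit Types (A B : Z2 -> F) (l : F * F) (h : {poly {poly F}}).

(** A linear form acts on all doubly infinite series, with no condition on
    supports.  Keeping products with polynomials as iterates of this action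
    avoids any associativity question for products of series. *)
Definition linmul l A : Z2 -> F := fun e =>
  l.1 * A (e.1 - 1, e.2) + l.2 * A (e.1, e.2 - 1).

Definition linmuls (ls : seq (F * F)) A : Z2 -> F := foldr linmul A ls.

Lemma linmulC l m A : linmul l (linmul m A) = linmul m (linmul l A).
Proof. by apply/funext => e; rewrite /linmul /=; ring. Qed.

Lemma linmul_linmuls l ls A : linmul l (linmuls ls A) = linmuls ls (linmul l A).
Proof. by elim: ls => //= m ls <-; rewrite linmulC. Qed.

Lemma linmulsC ls ms A : linmuls ls (linmuls ms A) = linmuls ms (linmuls ls A).
Proof. by elim: ls => //= l ls ->; rewrite linmul_linmuls. Qed.

Lemma linmuls_cat ls ms A : linmuls (ls ++ ms) A = linmuls ls (linmuls ms A).
Proof. by rewrite /linmuls foldr_cat. Qed.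

Lemma linmuls_nseq n l A : linmuls (nseq n l) A = iter n (linmul l) A.
Proof. by elim: n => //= n ->. Qed.

Lemma linmul_poly l h : linmul l (poly_series h) = poly_series (linform l * h).
Proof.
apply/funext => -[i j]; rewrite /linmul /poly_series /linform /var1 /var2 /=.
case: i => [i|i]; last first.
  have -> : (0 <= Negz i - 1) = false by lia.
  by rewrite /= !mulr0 addr0.
case: j => [j|j]; last first.
  have -> : (0 <= Negz j - 1) = false by lia.
  by rewrite /= !andbF !mulr0 addr0.
rewrite /= mulrDl coefD coefD -!mulrA !coefCM !coefXM.
congr (_ * _ + _ * _).
- by case: i => [|i] /=; rewrite ?coef0 // subn1.
- by case: j => [|j] //=; rewrite subn1.
Qed.

Lemma linmuls_poly ls h :
  linmuls ls (poly_series h) = poly_series (linprod ls * h).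
Proof.
elim: ls => [|l ls IH] /=; first by rewrite /linprod big_nil mul1r.
by rewrite IH linmul_poly /linprod big_cons mulrA.
Qed.

Lemma poly_series_inj : injective (@poly_series F).
Proof.
move=> h h' hh'; apply/polyP => i; apply/polyP => j.
by have := congr1 (fun A => A (Posz i, Posz j)) hh'; rewrite /poly_series /=.
Qed.

Lemma linform_eq0 l : (linform l == 0) = (l == 0).
Proof.
apply/eqP/eqP => [l0|->]; last by rewrite /linform !polyC0 !mul0r addr0.
have c i j : (linform l)`_i`_j = 0 by rewrite l0 !coef0.
have := c 1 0; have := c 0 1; rewrite /linform /var1 /var2 !coefD !coefCM.
rewrite !coefX !coefC /= !mulr0 !mulr1 add0r addr0 coefX mulr1.
by case: l {l0 c} => a b /= -> ->.
Qed.

Lemma linprod_neq0 (ls : seq (F * F)) : 0 \notin ls -> linprod ls != 0.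
Proof.
elim: ls => [|l ls IH]; first by rewrite /linprod big_nil oner_eq0.
rewrite inE negb_or /linprod big_cons => /andP[l0 ls0].
by rewrite mulf_neq0 ?IH // linform_eq0 eq_sym.
Qed.

(** Finite support conditions are expressed through half-planes of exponents,
    each of which is preserved, up to translation, by multiplication by a
    linear form. *)
Definition halfplane (a b : int) A : Prop :=
  exists N : int, forall e, A e != 0 -> a * e.1 + b * e.2 <= N.

Lemma linmul_halfplane a b l A : halfplane a b A -> halfplane a b (linmul l A).
Proof.
move=> [N AN]; exists (N + `|a| + `|b|) => -[i j]; rewrite /linmul /=.
case: (eqVneq (A (i - 1, j)) 0) => [->|/AN /=]; last first.
  by rewrite mulrBr mulr1; lia.
case: (eqVneq (A (i, j - 1)) 0) => [->|/AN /=]; last first.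
  by rewrite mulrBr mulr1; lia.
by rewrite !mulr0 addr0 eqxx.
Qed.

Lemma linmuls_halfplane a b ls A :
  halfplane a b A -> halfplane a b (linmuls ls A).
Proof. by move=> hA; elim: ls => //= l ls; exact: linmul_halfplane. Qed.

Lemma poly_series_halfplane a b h : a <= 0 -> b <= 0 ->
  halfplane a b (poly_series h).
Proof.
move=> a0 b0; exists 0 => -[i j]; rewrite /poly_series /=.
by case: ifP => [/andP[? ?] _|]; [nia | rewrite eqxx].
Qed.

End LinearMultiplication.

(** * Expansions of rational functions *)

Section Expansions.
Variables (F : fieldType) (inv : F * F -> Z2 -> F) (good : (Z2 -> F) -> Prop).
Implicit Types (A B : Z2 -> F) (h : {poly {poly F}}) (ls : seq (F * F)).

(** What an expansion convention must provide: a space of series, containing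
    the polynomials, on which every nonzero linear form acts bijectively, with
    inverse the product with its expanded reciprocal. *)
Record division_space : Prop := DivisionSpace {
  ds_poly : forall h, good (poly_series h);
  ds_linmul : forall l A, good A -> good (linmul l A);
  ds_inj : forall l A B, l != 0 -> good A -> good B ->
    linmul l A = linmul l B -> A = B;
  ds_good : forall l A, l != 0 -> good A -> good (smul (W := F^o) (inv l) A);
  ds_div : forall l A, l != 0 -> good A ->
    linmul l (smul (W := F^o) (inv l) A) = A }.

Hypothesis ds : division_space.

Lemma linmuls_good ls A : good A -> good (linmuls ls A).
Proof. by move=> gA; elim: ls => //= l ls; exact: ds_linmul. Qed.

Lemma linmuls_inj ls A B : 0 \notin ls -> good A -> good B ->
  linmuls ls A = linmuls ls B -> A = B.
Proof.
move=> + gA gB; elim: ls => //= l ls IH; rewrite inE negb_or eq_sym.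
move=> /andP[l0 ls0] AB; apply: IH => //.
by apply: (ds_inj ds l0) AB; exact: linmuls_good.
Qed.

(** This is the characterization through which all expansions are computed:
    clearing denominators determines a series of the space. *)
Lemma expandP h ls A : 0 \notin ls ->
  A = foldr (fun l (B : Z2 -> F^o) => smul (inv l) B) (poly_series h) ls <->
  good A /\ linmuls ls A = poly_series h.
Proof.
move=> ls0; set E := foldr _ _ _.
have [gE EE] : good E /\ linmuls ls E = poly_series h.
  rewrite {}/E; elim: ls ls0 => [|l ls IH] /=; first by split=> //; exact: ds_poly.
  rewrite inE negb_or eq_sym => /andP[l0 /IH[gE EE]].
  by split; [exact: ds_good | rewrite linmul_linmuls ds_div].
split=> [->//|[gA AE]].
by apply: (linmuls_inj ls0) => //; rewrite AE.
Qed.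

Lemma expands_series_uniq (f : {fraction {poly {poly F}}}) A B :
  expands inv f A -> expands inv f B -> A = B.
Proof.
move=> [h [ls [ls0 -> /(expandP _ _ ls0)[gA AE]]]].
move=> [h' [ls' [ls'0 + /(expandP _ _ ls'0)[gB BE]]]].
move=> /eqP; rewrite eqr_div ?tofrac_eq0 ?linprod_neq0 // -!tofracM tofrac_eq.
move=> /eqP hh'; apply: (@linmuls_inj (ls ++ ls')) => //.
  by rewrite mem_cat negb_or ls0.
by rewrite !linmuls_cat BE linmulsC AE !linmuls_poly mulrC hh' mulrC.
Qed.

Lemma expands_ratfun_uniq (f g : {fraction {poly {poly F}}}) A :
  expands inv f A -> expands inv g A -> f = g.
Proof.
move=> [h [ls [ls0 -> /(expandP _ _ ls0)[_ AE]]]].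
move=> [h' [ls' [ls'0 -> /(expandP _ _ ls'0)[_ AE']]]].
apply/eqP; rewrite eqr_div ?tofrac_eq0 ?linprod_neq0 // -!tofracM tofrac_eq.
apply/eqP/poly_series_inj; rewrite mulrC -linmuls_poly -AE linmulsC AE'.
by rewrite linmuls_poly mulrC.
Qed.

Lemma iotaE f A : expands inv f A -> Defs.iota inv f = A.
Proof.
by move=> fA; apply: xget_unique => // B fB; exact: expands_series_uniq fB fA.
Qed.

Lemma loc_S_expands f : loc_S f -> expands inv f (Defs.iota inv f).
Proof.
move=> [h [ls [ls0 fE]]]; apply: (xgetPex (fun=> 0)).
by exists (foldr (fun l (B : Z2 -> F^o) => smul (inv l) B) (poly_series h) ls), h, ls.
Qed.

Lemma iota_inj f g : loc_S f -> loc_S g -> Defs.iota inv f = Defs.iota inv g -> f = g.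
Proof.
move=> /loc_S_expands fA /loc_S_expands gA fg.
by apply: expands_ratfun_uniq gA; rewrite -fg.
Qed.

Lemma iota_linmuls h ls A : 0 \notin ls -> good A ->
  linmuls ls A = poly_series h -> Defs.iota inv (h%:F / (linprod ls)%:F) = A.
Proof.
by move=> ls0 gA AE; apply: iotaE; exists h, ls; split=> //; apply/expandP.
Qed.

Lemma iota_invK f : loc_S f -> iota_inv inv (Defs.iota inv f) = f.
Proof.
move=> Sf; apply: xget_unique => // g [Sg gf].
by apply: iota_inj => //.
Qed.

End Expansions.

(** * Products with powers of a binomial *)

Section BinomialPowers.
Variable F : fieldType.
Hypothesis F_char0 : [pchar F] =i pred0.
Implicit Types (A B : Z2 -> F) (n : int) (s : F) (l : F * F).

(** The product with (x + s y)^n is a finite sum in each coefficient.  This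
    holds for every series when n is a natural number, the binomial
    coefficients being eventually zero, and otherwise for series vanishing far
    down each antidiagonal; the condition covers both cases. *)
Definition tame n B : Prop := forall e : Z2, exists K : nat, forall i : nat,
  (K <= i)%N -> binomz F n i * B (e.1 + i%:Z, e.2 - i%:Z) = 0.

Lemma smul_binpowE s n B g (K : nat) :
  (forall i, (K <= i)%N -> binomz F n i * B (g.1 - n + i%:Z, g.2 - i%:Z) = 0) ->
  smul (W := F^o) (binpow s n) B g =
  \sum_(i < K) binomz F n i * s ^+ i * B (g.1 - n + i%:Z, g.2 - i%:Z).
Proof.
move=> BK; rewrite /smul (@fsum_nat _ _ (fun i => (n - i%:Z, i%:Z)) K).
- apply: eq_bigr => i _; rewrite /binpow /= eqxx /GRing.scale /=.
  congr (_ * B _); case: g {BK} => g1 g2; congr (_, _).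
  by rewrite /= opprB addrA addrAC.
- by move=> i j [_ ->].
case=> d1 d2; rewrite /binpow /=.
case: ifP => [/andP[d20 /eqP ->]|_]; last by rewrite scale0r eqxx.
have {d20}-> : d2 = `|d2|%N by lia.
move: `|d2|%N => i nz; exists i => //; rewrite ltnNge; apply/negP => /BK z.
move/negP: nz; apply; apply/eqP; rewrite /GRing.scale /= mulrAC.
have -> : g - (n - i%:Z, i%:Z) = (g.1 - n + i%:Z, g.2 - i%:Z).
  by case: g {BK z} => g1 g2; congr (_, _); rewrite /= opprB addrA addrAC.
by rewrite z mul0r.
Qed.

Lemma tame_succ n B : tame n B -> tame (n + 1) B.
Proof.
move=> tB [e1 e2]; have [K BK] := tB (e1, e2).
have [L BL] := tB (e1 + 1, e2 - 1).
exists (maxn K L).+1 => -[|i] // iKL /=; rewrite binomz_pascal // mulrDl.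
rewrite BK ?add0r; last by lia.
have := BL i; rewrite /= => <-; last by lia.
by congr (_ * B (_, _)); lia.
Qed.

Lemma tame0 B : tame 0 B.
Proof. by move=> e; exists 1%N => -[|i] // _; rewrite binomz_0S mul0r. Qed.

Lemma tame_nat (k : nat) B : tame k B.
Proof.
elim: k => [|k IH]; first exact: tame0.
by have := tame_succ IH; rewrite -addn1 PoszD.
Qed.

Lemma smul_binpow0 s B : smul (W := F^o) (binpow s 0) B = B.
Proof.
apply/funext => -[g1 g2]; rewrite (@smul_binpowE _ _ _ _ 1).
  by rewrite big_ord1 binomz0 !mul1r /=; congr (B (_, _)); lia.
by case=> // i _; rewrite binomz_0S mul0r.
Qed.

(** Pascal's rule, read as a recursion on the exponent. *)
Lemma linmul_smul_binpow s n B : tame n B ->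
  linmul (1, s) (smul (W := F^o) (binpow s n) B) =
  smul (W := F^o) (binpow s (n + 1)) B.
Proof.
move=> tB; apply/funext => -[g1 g2]; rewrite /linmul mul1r /=.
have [K BK] := tB (g1 - 1 - n, g2); have [L BL] := tB (g1 - n, g2 - 1).
have [N BN] := tame_succ tB (g1 - (n + 1), g2).
pose P := maxn K (maxn L N).
rewrite (@smul_binpowE _ _ _ _ P.+1) /=; last by move=> i Pi; apply: BK; lia.
rewrite (@smul_binpowE _ _ _ _ P) /=; last by move=> i Pi; apply: BL; lia.
rewrite (@smul_binpowE _ _ _ _ P.+1) /=; last by move=> i Pi; apply: BN; lia.
rewrite !big_ord_recl /= !binomz0 -addrA mulr_sumr; congr (_ + _).
  by congr (_ * B (_, _)); lia.
rewrite -big_split; apply: eq_bigr => i _ /=; rewrite binomz_pascal // /bump add1n.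
have -> : (g1 - (n + 1) + i.+1%:Z, g2 - i.+1%:Z) =
          (g1 - 1 - n + i.+1%:Z, g2 - i.+1%:Z) by congr (_, _); lia.
have -> : (g1 - n + i%:Z, g2 - 1 - i%:Z) =
          (g1 - 1 - n + i.+1%:Z, g2 - i.+1%:Z) by congr (_, _); lia.
by rewrite exprS; ring.
Qed.

Lemma smul_binpow_nat s (k : nat) B :
  smul (W := F^o) (binpow s k) B = linmuls (nseq k (1, s)) B.
Proof.
elim: k => [|k IH]; first exact: smul_binpow0.
rewrite /= -IH linmul_smul_binpow; last exact: tame_nat.
by rewrite -addn1 PoszD.
Qed.

(** * The two expansion conventions *)

(** In both conventions the admissible series are those whose exponents of the
    variable expanded in nonnegative powers are bounded below. *)
Lemma halfplane_tame n A : halfplane 0 (-1) A -> tame n A.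
Proof.
move=> [N AN] [e1 e2]; exists (`|N| + `|e2|).+1%N => i iN /=.
case: (eqVneq (A (e1 + i%:Z, e2 - i%:Z)) 0) => [->|/AN /=]; first by rewrite mulr0.
by move=> ?; exfalso; lia.
Qed.

Lemma smul_binpow_halfplane s n A : halfplane 0 (-1) A ->
  halfplane 0 (-1) (smul (W := F^o) (binpow s n) A).
Proof.
move=> hA; have [N AN] := hA; exists N => -[g1 g2].
have [K AK] := halfplane_tame n hA (g1 - n, g2).
rewrite (@smul_binpowE _ _ _ _ K) //= => nz.
rewrite mul0r add0r leNgt; apply/negP => gN; move/negP: nz; apply.
rewrite big1 // => i _; case: (eqVneq (A (g1 - n + i%:Z, g2 - i%:Z)) 0).
  by move=> ->; rewrite mulr0.
by move=> /AN /=; lia.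
Qed.

Lemma smul_invlin_y l A : l.1 != 0 -> smul (W := F^o) (invlin_y l) A =
  smul (W := F^o) (binpow (l.2 / l.1) (-1)) (fun e => l.1^-1 * A e).
Proof.
move=> l1; apply/funext => g; apply: eq_fsbigr => h _.
by rewrite /invlin_y l1 /GRing.scale /= mulrCA mulrA.
Qed.

Lemma smul_invlin_y0 l A : l.1 = 0 ->
  smul (W := F^o) (invlin_y l) A = fun g => l.2^-1 * A (g.1, g.2 + 1).
Proof.
move=> l1; apply/funext => -[g1 g2]; rewrite /smul.
rewrite (@fsum_nat _ _ (fun i => (i%:Z, -1)) 1).
- rewrite big_ord1 /invlin_y l1 eqxx /GRing.scale /=; congr (_ * A (_, _)) => /=; lia.
- by move=> i j [].
move=> d; rewrite /invlin_y l1 eqxx /=.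
by case: (eqVneq d (0, -1)) => [-> _|_]; [exists 0%N | rewrite scale0r eqxx].
Qed.

Lemma division_space_y : division_space (@invlin_y F) (halfplane 0 (-1)).
Proof.
split.
- by move=> h; exact: poly_series_halfplane.
- by move=> l A; exact: linmul_halfplane.
- case=> a b A B l0 [N AN] [L BL] /= AB; apply/funext.
  have AB' e1 e2 : a * A (e1, e2) + b * A (e1 + 1, e2 - 1) =
                   a * B (e1, e2) + b * B (e1 + 1, e2 - 1).
    have := congr1 (@^~ (e1 + 1, e2)) AB; rewrite /linmul /=.
    by have -> : e1 + 1 - 1 = e1 by lia.
  case: (eqVneq a 0) => [a0|a0].
    have b0 : b != 0 by apply: contraNneq l0 => b0; rewrite a0 b0.
    move=> [e1 e2]; have := AB' (e1 - 1) (e2 + 1).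
    have -> : (e1 - 1 + 1, e2 + 1 - 1) = (e1, e2) by congr (_, _); lia.
    by rewrite a0 !mul0r !add0r => /(mulfI b0).
  (* The coefficients with y-exponent e2 are determined by those with exponent
     e2 - 1, and both series vanish when e2 is sufficiently negative. *)
  have ind (n : nat) e1 e2 :
      e2 <= n%:Z - `|N| - `|L| - 1 -> A (e1, e2) = B (e1, e2).
    elim: n e1 e2 => [|n IH] e1 e2 en.
      case: (eqVneq (A (e1, e2)) 0) => [->|/AN /= ?]; last by exfalso; lia.
      by case: (eqVneq (B (e1, e2)) 0) => [->//|/BL /= ?]; exfalso; lia.
    have := AB' e1 e2; rewrite (IH (e1 + 1) (e2 - 1)); last lia.
    by move=> /addIr /(mulfI a0).
  by move=> [e1 e2]; apply: (ind (`|e2| + `|N| + `|L| + 1)%N); lia.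
- move=> l A l0 hA; case: (eqVneq l.1 0) => l1.
    rewrite smul_invlin_y0 //; have [N AN] := hA; exists (N + 1) => -[g1 g2] /= nz.
    have := AN (g1, g2 + 1); rewrite /=.
    case: (eqVneq (A (g1, g2 + 1)) 0) nz => [->|_ _ /(_ isT)]; first by rewrite mulr0 eqxx.
    by lia.
  rewrite smul_invlin_y //; apply: smul_binpow_halfplane.
  have [N AN] := hA; exists N => e; rewrite mulf_eq0 negb_or => /andP[_].
  exact: AN.
- move=> l A l0 hA; case: (eqVneq l.1 0) => l1.
    have l2 : l.2 != 0.
      by apply: contraNneq l0; case: l l1 => /= a b -> ->.
    rewrite smul_invlin_y0 //; apply/funext => -[g1 g2].
    rewrite /linmul l1 mul0r add0r mulVKf //=; congr (A (_, _)) => /=; lia.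
  rewrite smul_invlin_y //; set A' := fun e => _.
  have hA' : halfplane 0 (-1) A'.
    have [N AN] := hA; exists N => e; rewrite mulf_eq0 negb_or => /andP[_].
    exact: AN.
  have := linmul_smul_binpow (l.2 / l.1) (halfplane_tame (-1) hA').
  rewrite addNr smul_binpow0; set X := smul _ _ => XA'.
  apply/funext => e; have := congr1 (fun C => l.1 * C e) XA'.
  rewrite /A' /linmul /= mulVKf // => <-.
  by field.
Qed.

(** The convention expanding in powers of the first variable is the previous one
    with the roles of the variables exchanged. *)
Definition swap A : Z2 -> F := fun e => A (e.2, e.1).

Lemma swapK A : swap (swap A) = A.
Proof. by apply/funext => -[]. Qed.

Lemma smul_swap A B :
  smul (W := F^o) (swap A) B = swap (smul (W := F^o) A (swap B)).
Proof.
apply/funext => -[g1 g2]; rewrite /swap /smul /=.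
rewrite (reindex_fsbigT (fun e : Z2 => (e.2, e.1))) //=; last first.
  by exists (fun e : Z2 => (e.2, e.1)); case.
by apply: eq_fsbigr => -[i j] _.
Qed.

Lemma linmul_swap l A : linmul l (swap A) = swap (linmul (l.2, l.1) A).
Proof. by apply/funext => -[e1 e2]; rewrite /linmul /swap /= addrC. Qed.

Lemma halfplane_swap a b A : halfplane a b A -> halfplane b a (swap A).
Proof.
by move=> [N AN]; exists N => -[e1 e2] nz; rewrite addrC; apply: (AN (e2, e1)).
Qed.

Lemma division_space_x : division_space (@invlin_x F) (halfplane (-1) 0).
Proof.
have ds := division_space_y.
have swap_l0 l : l != 0 -> (l.2, l.1) != 0.
  by apply: contra_neq; case: l => a b [-> ->].
have invE l : invlin_x l = swap (invlin_y (l.2, l.1)) by [].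
split.
- by move=> h; exact: poly_series_halfplane.
- by move=> l A; exact: linmul_halfplane.
- move=> l A B l0 /halfplane_swap hA /halfplane_swap hB AB.
  rewrite -[A]swapK -[B]swapK; congr swap.
  apply: (ds_inj ds (swap_l0 _ l0)) => //.
  by rewrite !linmul_swap /=; case: l {l0} AB => a b /= ->.
- move=> l A l0 /halfplane_swap hA; rewrite invE smul_swap.
  by apply/halfplane_swap; exact: (ds_good ds (swap_l0 _ l0)).
- move=> l A l0 /halfplane_swap hA; rewrite invE smul_swap linmul_swap.
  by rewrite (ds_div ds (swap_l0 _ l0)) // swapK.
Qed.

End BinomialPowers.

(** * Substitution of a sum for the first variable *)

Section Substitution.
Variable F : fieldType.
Implicit Types (A B : Z2 -> F) (l : F * F) (h : {poly {poly F}}).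

Lemma subst_x0_plus_x2E (W : lmodType F) (A : Z2 -> W) (e : Z2) (K : nat) :
  (forall i, (K <= i)%N -> A (e.1 + i%:Z, e.2 - i%:Z) = 0) ->
  subst_x0_plus_x2 A e =
  \sum_(i < K) binomz F (e.1 + i%:Z) i *: A (e.1 + i%:Z, e.2 - i%:Z).
Proof.
have coef i : binpow (1 : F) (e.1 + i%:Z) (e.1, e.2 - (e.2 - i%:Z)) =
              binomz F (e.1 + i%:Z) i.
  rewrite /binpow /= opprB addrCA subrr addr0 addrK eqxx /=.
  by rewrite expr1n mulr1.
move=> AK; rewrite /subst_x0_plus_x2.
rewrite (@fsum_nat _ _ (fun i => (e.1 + i%:Z, e.2 - i%:Z)) K).
- by apply: eq_bigr => i _; rewrite coef.
- by move=> i j [/addrI []].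
case=> d1 d2 nz.
have [i dE] : exists i : nat, (d1, d2) = (e.1 + i%:Z, e.2 - i%:Z).
  move: nz; rewrite {1}/binpow /=.
  case: ifP => [/andP[? /eqP ?] _|_]; last by rewrite scale0r eqxx.
  exists `|e.2 - d2|%N; congr (_, _); lia.
exists i => //; rewrite ltnNge; apply/negP => /AK z.
by move/negP: nz; apply; rewrite dE z scaler0.
Qed.

Hypothesis F_char0 : [pchar F] =i pred0.
Local Notation subst := (@subst_x0_plus_x2 F F^o).

Lemma halfplane_diag A (e : Z2) : halfplane 0 (-1) A ->
  exists K : nat, forall i, (K <= i)%N -> A (e.1 + i%:Z, e.2 - i%:Z) = 0.
Proof.
move=> [N AN]; exists (`|N| + `|e.2|).+1%N => i iN.
case: (eqVneq (A (e.1 + i%:Z, e.2 - i%:Z)) 0) => // /AN /= ?; exfalso; lia.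
Qed.

(** Substituting x0 + x2 for x1 turns the action of a x1 + b x2 into that of
    a x0 + (a + b) x2: Pascal's rule again. *)
Lemma subst_linmul l A : halfplane 0 (-1) A ->
  subst (linmul l A) = linmul (l.1, l.1 + l.2) (subst A).
Proof.
case: l => a b hA; apply/funext => -[e1 e2]; rewrite /linmul /=.
have [K AK] := halfplane_diag (e1 - 1, e2) hA.
have [L AL] := halfplane_diag (e1, e2 - 1) hA.
pose P := maxn K L.
have AK' i : (P < i)%N -> A (e1 + i%:Z - 1, e2 - i%:Z) = 0.
  by move=> Pi; rewrite -(AK i) /=; [congr (A (_, _)); lia | lia].
have AL' i : (P <= i)%N -> A (e1 + i%:Z, e2 - i%:Z - 1) = 0.
  by move=> Pi; rewrite -(AL i) /=; [congr (A (_, _)); lia | lia].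
rewrite (@subst_x0_plus_x2E _ _ _ P.+1) /=; last first.
  by move=> i Pi; rewrite AK' // AL' ?mulr0 ?addr0 // ltnW.
rewrite (@subst_x0_plus_x2E _ _ _ P.+1) /=; last by move=> i Pi; apply: AK; lia.
rewrite (@subst_x0_plus_x2E _ _ _ P) /=; last by move=> i Pi; apply: AL; lia.
rewrite /GRing.scale /=.
pose u i := binomz F (e1 - 1 + i%:Z) i.
pose X i := A (e1 + i%:Z - 1, e2 - i%:Z).
have -> : \sum_(i < P.+1) binomz F (e1 - 1 + i%:Z) i * A (e1 - 1 + i%:Z, e2 - i%:Z)
          = X 0%N + \sum_(i < P) u i.+1 * X i.+1.
  rewrite big_ord_recl /= binomz0 mul1r; congr (_ + _).
    by rewrite /X; congr (A (_, _)); lia.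
  apply: eq_bigr => i _; rewrite /u /X /bump add1n.
  by congr (binomz _ _ _ * A (_, _)); lia.
have -> : \sum_(i < P) binomz F (e1 + i%:Z) i * A (e1 + i%:Z, e2 - 1 - i%:Z)
          = \sum_(i < P) binomz F (e1 + i%:Z) i * X i.+1.
  by apply: eq_bigr => i _; rewrite /X; congr (_ * A (_, _)); lia.
have -> : \sum_(i < P.+1) binomz F (e1 + i%:Z) i *
            (a * A (e1 + i%:Z - 1, e2 - i%:Z) + b * A (e1 + i%:Z, e2 - i%:Z - 1))
    = a * (X 0%N + \sum_(i < P) binomz F (e1 + i.+1%:Z) i.+1 * X i.+1)
      + b * \sum_(i < P) binomz F (e1 + i%:Z) i * X i.+1.
  rewrite (eq_bigr (fun i : 'I_P.+1 => a * (binomz F (e1 + i%:Z) i * X i)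
     + b * (binomz F (e1 + i%:Z) i * A (e1 + i%:Z, e2 - i%:Z - 1)))).
    rewrite big_split /= -!mulr_sumr; congr (_ * _ + _ * _).
      by rewrite big_ord_recl /= binomz0 mul1r.
    rewrite big_ord_recr /= AL' // mulr0 addr0.
    by apply: eq_bigr => i _; rewrite /X; congr (_ * A (_, _)); lia.
  by move=> i _; rewrite /X; ring.
have -> : \sum_(i < P) binomz F (e1 + i.+1%:Z) i.+1 * X i.+1 =
    \sum_(i < P) u i.+1 * X i.+1 + \sum_(i < P) binomz F (e1 + i%:Z) i * X i.+1.
  rewrite -big_split; apply: eq_bigr => i _ /=.
  have -> : e1 + i.+1%:Z = e1 + i%:Z + 1 by lia.
  rewrite binomz_pascal // /u mulrDl; congr (binomz _ _ _ * _ + _); lia.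
by ring.
Qed.

Lemma subst_linmuls ls A : halfplane 0 (-1) A ->
  subst (linmuls ls A) = linmuls [seq (l.1, l.1 + l.2) | l <- ls] (subst A).
Proof.
move=> hA; elim: ls => //= l ls IH.
by rewrite subst_linmul ?IH //; exact: linmuls_halfplane.
Qed.

(** Along each antidiagonal the substitution is unitriangular. *)
Lemma subst_inj A B : halfplane 0 (-1) A -> halfplane 0 (-1) B ->
  subst A = subst B -> A = B.
Proof.
move=> hA hB AB; have [N AN] := hA; have [L BL] := hB.
have ind (n : nat) (e1 e2 : int) :
    e2 <= n%:Z - `|N| - `|L| - 1 -> A (e1, e2) = B (e1, e2).
  elim: n e1 e2 => [|n IH] e1 e2 en.
    case: (eqVneq (A (e1, e2)) 0) => [->|/AN /= ?]; last by exfalso; lia.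
    by case: (eqVneq (B (e1, e2)) 0) => [->//|/BL /= ?]; exfalso; lia.
  have [K AK] := halfplane_diag (e1, e2) hA.
  have [J BJ] := halfplane_diag (e1, e2) hB.
  have := congr1 (@^~ (e1, e2)) AB; pose P := maxn K J.
  rewrite (@subst_x0_plus_x2E F^o A _ P.+1) /=; last by move=> i Pi; apply: AK; lia.
  rewrite (@subst_x0_plus_x2E F^o B _ P.+1) /=; last by move=> i Pi; apply: BJ; lia.
  rewrite !big_ord_recl /= !binomz0 !scale1r.
  rewrite (eq_bigr (fun i : 'I_P => binomz F (e1 + (bump 0 i)%:Z) (bump 0 i) *:
                  (B (e1 + (bump 0 i)%:Z, e2 - (bump 0 i)%:Z) : F^o))).
    by rewrite ?addr0 ?subr0 => /addIr.
  by move=> i _; rewrite IH // /bump add1n; lia.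
by apply/funext => -[e1 e2]; apply: (ind (`|e2| + `|N| + `|L| + 1)%N); lia.
Qed.

Lemma poly_seriesD (p q : {poly {poly F}}) :
  poly_series (p + q) = (fun e => poly_series p e + poly_series q e).
Proof.
by apply/funext => e; rewrite /poly_series; case: ifP; rewrite ?addr0 // !coefD.
Qed.

Lemma substD A B : halfplane 0 (-1) A -> halfplane 0 (-1) B ->
  subst (fun e => A e + B e) = (fun e => subst A e + subst B e).
Proof.
move=> hA hB; apply/funext => e.
have [K AK] := halfplane_diag e hA; have [L BL] := halfplane_diag e hB.
rewrite !(@subst_x0_plus_x2E F^o _ _ (maxn K L)).
- by rewrite -big_split; apply: eq_bigr => i _; rewrite scalerDr.
- by move=> i iKL; apply: BL; lia.
- by move=> i iKL; apply: AK; lia.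
- by move=> i iKL; rewrite AK ?BL ?addr0 //; lia.
Qed.

Lemma poly_series_y h : halfplane 0 (-1) (poly_series h : Z2 -> F).
Proof. exact: poly_series_halfplane. Qed.

Lemma subst_const (a : F) :
  subst (poly_series a%:P%:P) = poly_series a%:P%:P.
Proof.
apply/funext => -[e1 e2].
have [K aK] := halfplane_diag (e1, e2) (poly_series_y a%:P%:P).
rewrite (@subst_x0_plus_x2E F^o _ _ K.+1); last first.
  by move=> i Ki; apply: aK; lia.
rewrite big_ord_recl big1 ?addr0 /= ?addr0 ?subr0 ?binomz0 ?scale1r // => i _.
(* A term with i > 0 can only come from exponent 0 in the first variable, and
   (x0 + x2)^0 has no such term. *)
rewrite /bump add1n; case: (eqVneq (e1 + i.+1%:Z) 0) => [->|ei].
  by rewrite binomz_0S scale0r.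
rewrite /poly_series /=; case: ifP => [/andP[e0 _]|]; last by rewrite scaler0.
rewrite coefC absz_eq0 (negPf ei).
by rewrite coef0 scaler0.
Qed.

(** Powers of the second variable pass through the substitution unchanged. *)
Lemma subst_polyC (c : {poly F}) : subst (poly_series c%:P) = poly_series c%:P.
Proof.
elim/poly_ind: c => [|c a IH]; first by rewrite -polyC0 subst_const.
have -> : (c * 'X + a%:P)%:P = linform (0, 1) * c%:P + a%:P%:P.
  by rewrite /linform /var2 /= polyC0 polyC1 mul0r add0r mul1r polyCD polyCM mulrC.
rewrite poly_seriesD substD; try exact: poly_series_y.
rewrite subst_const -linmul_poly subst_linmul; last exact: poly_series_y.
by rewrite /= add0r IH.
Qed.

(** The change of variables x0 = x1 - x2 in a polynomial, followed by the
    expansion of x1 = x0 + x2, is the identity. *)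
Lemma subst_poly h :
  subst (poly_series (h \Po (var1 - var2))) = poly_series h.
Proof.
have var12 : var1 - var2 = linform (1, -1) :> {poly {poly F}}.
  by rewrite /linform /= !polyCN !polyC1 mul1r mulN1r.
elim/poly_ind: h => [|h c IH]; first by rewrite comp_poly0 -polyC0 subst_polyC.
rewrite comp_polyD comp_polyM comp_polyX comp_polyC.
rewrite !poly_seriesD substD; try exact: poly_series_y.
rewrite subst_polyC mulrC {1}var12 -linmul_poly subst_linmul; last exact: poly_series_y.
rewrite IH /= subrr linmul_poly /linform /= polyC1 polyC0 mul1r mul0r addr0.
by rewrite mulrC.
Qed.

End Substitution.

(** * Weights in iterated coproducts *)

Section Weights.
Variable F : fieldType.

Lemma lin_sum (U W : lmodType F) (f : U -> W) : linear f ->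
  forall (I : Type) (s : seq I) (g : I -> U),
    f (\sum_(i <- s) g i) = \sum_(i <- s) f (g i).
Proof.
move=> lf I s g; pose L : {linear U -> W} :=
  HB.pack f (GRing.isLinear.Build F U W *:%R f lf).
exact: (raddf_sum L).
Qed.

Lemma tmap_linear (U V W X : lmodType F) (f : U -> W) (g : V -> X) :
  linear f -> linear g -> bilinear_map (fun v w => tpure (f v) (g w)).
Proof.
move=> lf lg; split=> [w a u v|v a u w].
- by rewrite lf (tpure_bilinear W X).1.
- by rewrite lg (tpure_bilinear W X).2.
Qed.

Lemma tassoc_linear2 (U V W : lmodType F) (u : U) :
  bilinear_map (fun (v : V) (w : W) => tpure (tpure u v) w).
Proof.
split=> [w a x y|v a x y].
- by rewrite (tpure_bilinear U V).2 (tpure_bilinear (U ⊗ V) W).1.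
- by rewrite (tpure_bilinear (U ⊗ V) W).2.
Qed.

Lemma tassoc_linear (U V W : lmodType F) : bilinear_map
  (fun u : U => tens_lift (fun (v : V) (w : W) => tpure (tpure u v) w)).
Proof.
split=> [x a u v|u]; last by apply: tens_lift_linear; exact: tassoc_linear2.
rewrite /tens_lift scaler_sumr -big_split; apply: eq_bigr => p _ /=.
by rewrite (tpure_bilinear U V).1 (tpure_bilinear (U ⊗ V) W).1.
Qed.

Lemma linear0E (U W : lmodType F) (f : U -> W) : linear f -> f 0 = 0.
Proof. by move=> /lin_sum /(_ nat [::] (fun=> 0)); rewrite !big_nil. Qed.

Section TensorGrading.
Variables (I J K : Type) (add : I -> J -> K) (V W : lmodType F).
Variables (GV : I -> set V) (GW : J -> set W).

Lemma tgrade_pure i j k v w : add i j = k -> GV i v -> GW j w ->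
  tgrade add GV GW k (tpure v w).
Proof.
move=> ijk Gv Gw; exists [:: (v, w)]; rewrite big_seq1; split=> // p.
by rewrite inE => /eqP ->; exists i, j.
Qed.

Lemma tgrade_sum k (T : eqType) (s : seq T) (x : T -> V ⊗ W) :
  (forall t, t \in s -> tgrade add GV GW k (x t)) ->
  tgrade add GV GW k (\sum_(t <- s) x t).
Proof.
elim: s => [|t s IH] xs; first by exists [::]; rewrite !big_nil.
have [|r [rP xr]] := IH; first by move=> u us; apply: xs; rewrite inE us orbT.
have [q [qP xt]] := xs t (mem_head _ _).
exists (q ++ r); rewrite big_cons big_cat xt xr; split=> // p.
by rewrite mem_cat => /orP[/qP|/rP].
Qed.

(** Linear maps out of a homogeneous component of a tensor product are
    controlled by their values on homogeneous pure tensors. *)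
Lemma tgrade_elim k (X : lmodType F)
    (P : X -> Prop) (f : V ⊗ W -> X) : linear f ->
  (forall (T : eqType) (s : seq T) (x : T -> X),
     (forall t, t \in s -> P (x t)) -> P (\sum_(t <- s) x t)) ->
  (forall i j v w, add i j = k -> GV i v -> GW j w -> P (f (tpure v w))) ->
  forall x, tgrade add GV GW k x -> P (f x).
Proof.
move=> lf Psum Ppure x [s [sP ->]]; rewrite lin_sum //; apply: Psum => p ps.
by have [i [j [ijk Gv Gw]]] := sP p ps; exact: Ppure ijk Gv Gw.
Qed.

End TensorGrading.
End Weights.

Section ComoduleSupport.
Variables (F : fieldType) (V : lmodType F) (GV : int -> set V).
Variables (YV : int -> {linear V -> V ⊗ V}) (c : {scalar V}).
Hypothesis V_gvc : graded_vertex_coalgebra YV c GV.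
Variables (M : lmodType F) (GM : rat -> set M) (YM : int -> {linear M -> V ⊗ M}).
Hypothesis M_com : comodule_but_jacobi GV c GM YM.

Lemma YV_weight i n v : GV i v -> tgrade +%R GV GV (i - n) (YV n v).
Proof.
move=> /(gvc_weight V_gvc (- n - 1)).
have -> : - (- n - 1) - 1 = n by lia.
by have -> : i + (- n - 1) + 1 = i - n by lia.
Qed.

Lemma YM_weight j n w : GM j w -> tgrade addzq GV GM (j - n%:~R) (YM n w).
Proof.
move=> /(com_weight M_com (- n - 1)).
have -> : - (- n - 1) - 1 = n by lia.
by have -> : j + (- n - 1)%:~R + 1 = j - n%:~R by rewrite rmorphB rmorphN /=; ring.
Qed.

Lemma id_linear (U : lmodType F) : linear (id : U -> U).
Proof. by []. Qed.

Lemma YM_linear n : linear (YM n).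
Proof. by move=> a u v; rewrite linearP. Qed.

Lemma YV_linear n : linear (YV n).
Proof. by move=> a u v; rewrite linearP. Qed.

Let left_bil n := tmap_linear (YV_linear n) (@id_linear M).
Let right_bil n := tmap_linear (@id_linear V) (YM_linear n).
Let assoc_bil := tassoc_linear V V M.

Lemma Yleft_linear (e : Z2) : linear (Yleft YV YM ^~ e).
Proof.
move=> a u v; rewrite /Yleft /tmap YM_linear.
by rewrite (tens_lift_linear (left_bil e.1)).
Qed.

Lemma Yright_linear (e : Z2) : linear (Yright YM ^~ e).
Proof.
move=> a u v; rewrite /Yright /tmap /tassoc YM_linear.
by rewrite (tens_lift_linear (right_bil e.2)) (tens_lift_linear assoc_bil).
Qed.

(** In both iterates the total weight is lowered by the total exponent. *)
Lemma Yleft_weight j w (e : Z2) : GM j w ->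
  grade_VVM GV GM (j - (e.1 + e.2)%:~R) (Yleft YV YM w e).
Proof.
move=> /(YM_weight e.2).
apply: (tgrade_elim (P := grade_VVM GV GM _) (tens_lift_linear (left_bil e.1))).
- by move=> T s x; exact: tgrade_sum.
move=> i q v m iq Gv Gm; rewrite /tmap tens_liftE //.
apply: tgrade_pure (YV_weight e.1 Gv) Gm.
have <- : i%:~R + q + e.2%:~R = j by rewrite [i%:~R + q]iq subrK.
by rewrite /addzq !rmorphD rmorphN /=; ring.
Qed.

Lemma Yright_weight j w (e : Z2) : GM j w ->
  grade_VVM GV GM (j - (e.1 + e.2)%:~R) (Yright YM w e).
Proof.
move=> /(YM_weight e.1); rewrite /Yright.
have lin : linear (fun x => @tassoc F V V M (tmap id (YM e.2) x)).
  move=> a x y; rewrite /tmap /tassoc.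
  by rewrite (tens_lift_linear (right_bil e.2)) (tens_lift_linear assoc_bil).
apply: (tgrade_elim (P := grade_VVM GV GM _) lin); first by move=> T s x; exact: tgrade_sum.
move=> i q v m iq Gv /(YM_weight e.2).
rewrite /tmap tens_liftE // /tassoc tens_liftE //.
have lin2 : linear (tens_lift (fun (v2 : V) (m2 : M) => tpure (tpure v v2) m2)).
  by apply: tens_lift_linear; exact: tassoc_linear2.
apply: (tgrade_elim (P := grade_VVM GV GM _) lin2).
  by move=> T s x; exact: tgrade_sum.
move=> i' q' v2 m2 iq' Gv2 Gm2; rewrite tens_liftE; last exact: tassoc_linear2.
apply: (tgrade_pure (i := i + i') (j := q')) => //; last exact: tgrade_pure Gv Gv2.
rewrite /addzq in iq iq'; have <- : i%:~R + q + e.1%:~R = j by rewrite iq subrK.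
have <- : i'%:~R + q' + e.2%:~R = q by rewrite iq' subrK.
by rewrite /addzq !rmorphD /=; ring.
Qed.

Lemma int_shift_bounded (S : seq rat) (j : rat) :
  exists D : int, forall n : int, j - n%:~R \in S -> `|n| <= D.
Proof.
elim: S => [|q S [D DS]]; first by exists 0 => n; rewrite in_nil.
case: (pselect (exists n : int, j - n%:~R = q)) => [[m mq]|no].
  exists (`|D| + `|m|) => n; rewrite inE => /orP[/eqP|/DS]; last by lia.
  by rewrite -mq => /addrI /oppr_inj /eqP; rewrite eqr_int => /eqP ->; lia.
exists D => n; rewrite inE => /orP[/eqP nq|/DS //].
by case: no; exists n.
Qed.

(** A functional in the graded dual therefore sees only finitely many total
    degrees of such an iterate. *)
Lemma total_degree_bounded (v' : {scalar (V ⊗ V) ⊗ M})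
    (Y : M -> Z2 -> (V ⊗ V) ⊗ M) (w : M) :
  in_graded_dual (grade_VVM GV GM) v' ->
  (forall e, linear (Y ^~ e)) ->
  (forall j u (e : Z2), GM j u ->
     grade_VVM GV GM (j - (e.1 + e.2)%:~R) (Y u e)) ->
  exists D : int, forall e : Z2, v' (Y w e) != 0 -> `|e.1 + e.2| <= D.
Proof.
move=> [S v'S] Ylin Yweight.
have [s [f [_ fG ->]]] := grading_span (com_grading M_com) w.
elim: s => [|j s [D Ds]].
  by exists 0 => e; rewrite big_nil (linear0E (Ylin e)) linear0 eqxx.
have [E EP] := int_shift_bounded S j; exists (`|D| + `|E|) => e.
rewrite big_cons -[f j]scale1r (Ylin e) scale1r linearD.
case: (eqVneq (v' (Y (f j) e)) 0) => [->|nz _].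
  by rewrite add0r => /Ds; lia.
have : j - (e.1 + e.2)%:~R \in S; last by move=> /EP; lia.
apply/negPn/negP => jS; move/eqP: nz; apply.
by apply: (v'S _ jS); exact: Yweight.
Qed.

Lemma Yleft_truncation w : exists N : int, forall e : Z2,
  N < e.2 -> Yleft YV YM w e = 0.
Proof.
have [N wN] := com_truncation M_com w; exists N => e Ne.
by rewrite /Yleft wN // /tmap (linear0E (tens_lift_linear (left_bil e.1))).
Qed.

Lemma Yright_truncation w : exists N : int, forall e : Z2,
  N < e.1 -> Yright YM w e = 0.
Proof.
have [N wN] := com_truncation M_com w; exists N => e Ne.
rewrite /Yright wN // /tmap (linear0E (tens_lift_linear (right_bil e.2))).
exact: linear0E (tens_lift_linear assoc_bil).
Qed.

End ComoduleSupport.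

(** * The rational change of variables *)

Section RationalSubstitution.
Variable F : fieldType.
Local Notation R := {poly {poly F}}.
Implicit Types (h g : R) (l : F * F).

(** The substitution is defined through a chosen representative of the
    fraction, hence the interest of relating it to the fraction itself. *)
Lemma numden_frac (f : {fraction R}) :
  f * (\d_(repr f))%:F = (\n_(repr f))%:F.
Proof.
rewrite -{1}[f]reprK; unlock FracField.tofrac; rewrite -[LHS]FracField.pi_mul.
apply/eqmodP; rewrite /= FracField.equivfE /FracField.mulf.
by rewrite !numden_Ratio ?mulf_neq0 ?oner_eq0 ?denom_ratioP //= !mulr1 mulrC.
Qed.

Lemma comp_var12_eq0 h : (h \Po (var1 - var2) == 0) = (h == 0).
Proof. by rewrite comp_poly2_eq0 // /var1 /var2 size_XsubC. Qed.

Lemma subst_x_minus_y_frac h g : g != 0 ->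
  subst_x_minus_y (h%:F / g%:F) =
  (h \Po (var1 - var2))%:F / (g \Po (var1 - var2))%:F.
Proof.
move=> g0; rewrite /subst_x_minus_y; set f := h%:F / g%:F.
have d0 : \d_(repr f) != 0 by exact: denom_ratioP.
apply/eqP; rewrite eqr_div ?tofrac_eq0 ?comp_var12_eq0 // -!tofracM tofrac_eq.
rewrite -!comp_polyM; apply/eqP; congr (_ \Po _); apply/eqP.
rewrite -tofrac_eq !tofracM -numden_frac /f mulrAC divfK ?tofrac_eq0 //.
Qed.

Lemma linform_comp l :
  linform l \Po (var1 - var2) = linform (l.1, l.2 - l.1).
Proof.
rewrite /linform comp_polyD !comp_polyM comp_polyX !comp_polyC /=.
by rewrite !polyCB /var2; ring.
Qed.

Lemma linprod_comp ls :
  linprod ls \Po (var1 - var2) = linprod [seq (l.1, l.2 - l.1) | l <- ls] :> R.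
Proof.
elim: ls => [|l ls IH] /=; first by rewrite /linprod !big_nil -polyC1 comp_polyC.
by rewrite /linprod !big_cons comp_polyM linform_comp [X in _ * X]IH.
Qed.

Lemma linprod_nseq n l : linprod (nseq n l) = linform l ^+ n.
Proof. by rewrite /linprod big_nseq; elim: n => //= n ->; rewrite exprS. Qed.

Lemma linprod_cat ls ms : linprod (ls ++ ms) = linprod ls * linprod ms :> R.
Proof. by rewrite /linprod big_cat. Qed.

(** Half-plane bounds add up, so bounds in independent directions confine the
    support to a bounded set. *)
Lemma halfplane_add a b a' b' (A : Z2 -> F) :
  halfplane a b A -> halfplane a' b' A -> halfplane (a + a') (b + b') A.
Proof.
move=> [N AN] [L AL]; exists (N + L) => e nz.
by have := AN e nz; have := AL e nz; rewrite !mulrDl; lia.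
Qed.

(** A series of finite support is a Laurent polynomial. *)
Lemma finite_support_poly (A : Z2 -> F) :
  halfplane 1 0 A -> halfplane (-1) 0 A ->
  halfplane 0 1 A -> halfplane 0 (-1) A ->
  exists (m : nat) (h : R),
    linmuls (nseq m (1, 0) ++ nseq m (0, 1)) A = poly_series h.
Proof.
move=> [a aA] [b bA] [c cA] [d dA]; pose m := (`|a| + `|b| + `|c| + `|d|).+1%N.
(* Both exponents lie in the open interval (-m, m); multiplying by x^m y^m moves
   the support into the square [0, 2m) x [0, 2m). *)
exists m, (\poly_(i < m.*2) \poly_(j < m.*2) A (i%:Z - m%:Z, j%:Z - m%:Z)).
have shift1 n B (e : Z2) :
    iter n (linmul (1, 0)) B e = B (e.1 - n%:Z, e.2) :> F.
  elim: n e => [|n IH] [e1 e2]; first by rewrite /= subr0.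
  by rewrite iterS /linmul mul1r mul0r addr0 IH /=; congr (B (_, _)); lia.
have shift2 n B (e : Z2) :
    iter n (linmul (0, 1)) B e = B (e.1, e.2 - n%:Z) :> F.
  elim: n e => [|n IH] [e1 e2]; first by rewrite /= subr0.
  by rewrite iterS /linmul mul1r mul0r add0r IH /=; congr (B (_, _)); lia.
apply/funext => -[e1 e2]; rewrite linmuls_cat !linmuls_nseq shift1 shift2 /=.
have AE : A (e1 - m%:Z, e2 - m%:Z) != 0 ->
    [&& 0 <= e1, e1 < m.*2%:Z, 0 <= e2 & e2 < m.*2%:Z].
  move=> nz; have := (aA _ nz, bA _ nz, cA _ nz, dA _ nz); rewrite /= /m.
  by move=> [[[? ?] ?] ?]; apply/and4P; split; lia.
rewrite /poly_series /=; case: ifP => [/andP[e10 e20]|nn]; last first.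
  case: (eqVneq (A (e1 - m%:Z, e2 - m%:Z)) 0) => // /AE /and4P[e10 _ e20 _].
  by rewrite e10 e20 in nn.
rewrite coef_poly; case: ltnP => [e1m|me1]; last first.
  rewrite coef0; case: (eqVneq (A (e1 - m%:Z, e2 - m%:Z)) 0) => // /AE /and4P[*].
  by exfalso; lia.
rewrite coef_poly; case: ltnP => [e2m|me2]; last first.
  case: (eqVneq (A (e1 - m%:Z, e2 - m%:Z)) 0) => // /AE /and4P[*].
  by exfalso; lia.
by rewrite !gez0_abs.
Qed.

End RationalSubstitution.

(** * The common numerator *)

Section CommonNumerator.
Variable F : fieldType.
Hypothesis F_char0 : [pchar F] =i pred0.
Local Notation R := {poly {poly F}}.
Local Notation subst := (@subst_x0_plus_x2 F F^o).
Implicit Types (A B : Z2 -> F).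

Lemma linmulsB ls A B :
  linmuls ls (fun e => A e - B e) = (fun e => linmuls ls A e - linmuls ls B e).
Proof.
elim: ls => //= l ls ->; apply/funext => e; rewrite /linmul; ring.
Qed.

Lemma subst_halfplane A : halfplane 0 (-1) A -> halfplane 0 (-1) (subst A).
Proof.
move=> hA; have [N AN] := hA; exists N => e.
have [K AK] := halfplane_diag e hA.
rewrite (@subst_x0_plus_x2E F F^o A e K) // => nz.
rewrite mul0r add0r leNgt; apply/negP => eN; move/eqP: nz; apply.
rewrite big1 // => i _; case: (eqVneq (A (e.1 + i%:Z, e.2 - i%:Z)) 0).
  by move=> ->; rewrite scaler0.
by move=> /AN /= ?; exfalso; lia.
Qed.

(** Transport of a clearing of denominators through x1 = x0 + x2. *)
Lemma linmuls_subst_poly (ls : seq (F * F)) h A : halfplane 0 (-1) A ->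
  linmuls ls (subst A) = poly_series h ->
  linmuls [seq (l.1, l.2 - l.1) | l <- ls] A =
  poly_series (h \Po (var1 - var2)).
Proof.
move=> hA lsA; apply: (@subst_inj F).
- exact: linmuls_halfplane.
- exact: poly_series_y.
rewrite subst_linmuls // subst_poly // -lsA -map_comp -[in RHS](map_id ls).
by congr linmuls; apply: eq_map => -[a b] /=; rewrite addrC subrK.
Qed.

(** The heart of the matter: after multiplication by a power of x0 + x2 the
    two series agree, and the support conditions of one complement those of
    the other, so that only finitely many monomials can survive. *)
Lemma common_numerator (k : nat) A B :
  halfplane 1 1 B -> halfplane (-1) (-1) B -> halfplane 0 1 B ->
  halfplane 0 (-1) A ->
  linmuls (nseq k (1, 1)) B = linmuls (nseq k (1, 1)) (subst A) ->
  exists (m : nat) (h : R),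
    let ls : seq (F * F) := nseq m (1, 0) ++ nseq m (0, 1) ++ nseq k (1, 1) in
    linmuls ls B = poly_series h /\ linmuls ls (subst A) = poly_series h.
Proof.
move=> B11 Bm1 B01 hA BA.
have P11 := linmuls_halfplane (nseq k (1, 1)) B11.
have P01 := linmuls_halfplane (nseq k (1, 1)) B01.
have Pm1 := linmuls_halfplane (nseq k (1, 1)) Bm1.
have P0m := linmuls_halfplane (nseq k (1, 1)) (subst_halfplane hA).
rewrite -BA in P0m.
have P10 := halfplane_add P11 P0m; have Pm0 := halfplane_add Pm1 P01.
rewrite ?addr0 ?subrr ?addNr in P10 Pm0.
have [m [h mh]] := finite_support_poly P10 Pm0 P01 P0m.
exists m, h => ls; rewrite /ls catA.
by split; rewrite linmuls_cat; [exact: mh | rewrite -[X in linmuls _ X]BA].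
Qed.

End CommonNumerator.

(** * Rationality and coassociativity *)

Theorem proposition4p6 (F : fieldType) (F_char0 : [pchar F] =i pred0)
    (V : lmodType F) (GV : int -> set V)
    (YV : int -> {linear V -> V ⊗ V}) (c : {scalar V})
    (V_gvc : graded_vertex_coalgebra YV c GV)
    (M : lmodType F) (GM : rat -> set M) (YM : int -> {linear M -> V ⊗ M})
    (M_com : comodule_but_jacobi GV c GM YM)
    (M_wca : weak_coassociativity GV YV GM YM)
    (v' : {scalar (V ⊗ V) ⊗ M}) (v'_dual : in_graded_dual (grade_VVM GV GM) v')
    (w : M) :
  let B : Z2 -> F := fun e => v' (Yleft YV YM w e) in
  let A : Z2 -> F := fun e => v' (Yright YM w e) in
  (left_rational_series B /\
   exists k : {fraction {poly {poly F}}},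
     [/\ loc_S k,
         B = iota20 k,
         forall k', loc_S k' -> B = iota20 k' -> k' = k
       & exists (h : {poly {poly F}}) (r s t : int),
           k = h%:F / (var1%:F ^ r * var2%:F ^ s * (var1 + var2)%:F ^ t)]) /\
  [/\ iota12_image A, iota20_image B
    & iota12_inv A = subst_x_minus_y (iota20_inv B)].
Proof.
move=> B A.
have [D BD] : exists D : int, forall e : Z2, B e != 0 -> `|e.1 + e.2| <= D.
  apply: (total_degree_bounded M_com _ v'_dual) => [e|j u e].
    exact: Yleft_linear.
  exact: (Yleft_weight V_gvc M_com).
have [E AE] : exists E : int, forall e : Z2, A e != 0 -> `|e.1 + e.2| <= E.
  apply: (total_degree_bounded M_com _ v'_dual) => [e|j u e].
    exact: Yright_linear.
  exact: (Yright_weight M_com).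
have [N BN] := Yleft_truncation YV M_com w.
have [L AL] := Yright_truncation M_com w.
(* For e1 + e2 in a bounded range, the upper bound on the exponent of x2 in B
   gives a lower bound on that of x0; likewise with x1 and x2 for A. *)
have B11 : halfplane 1 1 B by exists D => e /BD; lia.
have Bm1 : halfplane (-1) (-1) B by exists D => e /BD; lia.
have B01 : halfplane 0 1 B.
  exists N => e nz; rewrite mul0r mul1r add0r leNgt; apply/negP => /BN Be.
  by move/eqP: nz; apply; rewrite /B Be linear0.
have hB : halfplane (-1) 0 B.
  by have := halfplane_add Bm1 B01; rewrite addr0 addNr.
have hA : halfplane 0 (-1) A.
  exists (L + E) => e nz; have := AE e nz.
  case: (lerP e.1 L) => [|/AL Ae]; first by lia.
  by move/eqP: nz; case; rewrite /A Ae linear0.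
have [k [k0 /(_ w) wk]] := M_wca v' v'_dual.
have v'subst e : v' (subst_x0_plus_x2 (Yright YM w) e) =
                 subst_x0_plus_x2 (A : Z2 -> F^o) e.
  (* Truncation in x1 makes the vector-valued substitution a finite sum, so that
     v' can be applied term by term. *)
  have trunc i : (`|L - e.1|.+1 <= i)%N -> Yright YM w (e.1 + i%:Z, e.2 - i%:Z) = 0.
    by move=> iL; apply: AL => /=; lia.
  rewrite (subst_x0_plus_x2E trunc) (@subst_x0_plus_x2E F F^o A e `|L - e.1|.+1).
    by rewrite linear_sum; apply: eq_bigr => i _; rewrite linearZ.
  by move=> i /trunc Ai; rewrite /A Ai linear0.
have BA : linmuls (nseq k (1, 1)) B =
          linmuls (nseq k (1, 1)) (subst_x0_plus_x2 (A : Z2 -> F^o)).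
  have BA : (fun e => B e - subst_x0_plus_x2 (A : Z2 -> F^o) e) =
            (fun e => v' (Yleft YV YM w e - subst_x0_plus_x2 (Yright YM w) e)).
    by apply/funext => d; rewrite linearB /= v'subst.
  move: wk; rewrite -BA smul_binpow_nat // linmulsB => BA0.
  by apply/funext => e; apply/eqP; rewrite -subr_eq0 (congr1 (@^~ e) BA0).
have [m [h []]] := common_numerator B11 Bm1 B01 hA BA.
set ls := _ ++ _ => lsB lsA.
pose ls' := [seq (l.1, l.2 - l.1) | l <- ls].
have ls0 : 0 \notin ls.
  by rewrite !mem_cat !mem_nseq !xpair_eqE [0 == 1]eq_sym oner_eq0 !andbF.
have ls'0 : 0 \notin ls'.
  apply: contra ls0 => /mapP [[a b] abls [a0 /eqP]].
  by rewrite -a0 subr0 eq_sym => /eqP b0; move: abls; rewrite -a0 b0.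
pose kB := h%:F / (linprod ls)%:F.
pose kA := (h \Po (var1 - var2))%:F / (linprod ls')%:F.
have SB : loc_S kB by exists h, ls.
have SA : loc_S kA by exists (h \Po (var1 - var2)), ls'.
have dsx := division_space_x F_char0; have dsy := division_space_y F_char0.
have iB : iota20 kB = B by exact: (iota_linmuls dsx ls0 hB lsB).
have iA : iota12 kA = A.
  apply: (iota_linmuls dsy ls'0 hA).
  exact: (linmuls_subst_poly F_char0 hA lsA).
split; split.
- have [P BP] := hB; exists (`|P| + `|N|) => e nz.
  have := BP e nz; have [eN|/BN Be] := lerP e.2 N; first by lia.
  by move/eqP: nz; case; rewrite /B Be linear0.
- exists kB; split => //.
    move=> k' Sk' Bk'; apply: (iota_inj dsx) => //.
    exact: etrans (esym Bk') (esym iB).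
  exists h, m, m, k; rewrite /kB /ls !linprod_cat !linprod_nseq /linform /=.
  rewrite !polyC0 !polyC1 !mul1r !mul0r addr0 add0r !tofracM !tofracXn.
  by rewrite mulrA.
- by exists kA.
- by exists kB.
rewrite -[in LHS]iA -iB /iota12_inv /iota20_inv.
rewrite (iota_invK dsy SA) (iota_invK dsx SB).
by rewrite /kB subst_x_minus_y_frac ?linprod_neq0 // linprod_comp.
Qed.
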